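(* Let $G$ be a chordal graph. Then the following are equivalent: (a) $\mathcal{L}(G)=c(G)$; (b) $G$ is a strongly interval graph.
   Context: All graphs are finite and simple. A graph is chordal if it has no induced cycle of length greater than $3$. $c(G)$ denotes the number of maximal cliques of $G$ (maximal sets of pairwise adjacent vertices; an isolated vertex is a maximal clique). $\mathcal{L}(G)$ denotes the sum, over all connected components of $G$, of the length (number of edges) of a longest induced path of that component. Interval graph on a finite family of real closed intervals: each vertex is labeled by a real closed interval (the family is indexed, one vertex per index), and two distinct vertices are adjacent if and only if their intervals have non-empty intersection. Write $\mathbb{N}_0=\mathbb{N}\cup\{0\}$, with $\mathbb{N}=\{1,2,\ldots\}$. Connected strongly interval graph: let $k\in\mathbb{N}$ and $r\in\mathbb{N}_0$; let $J_0=[0]=\{0\}$, $J_i=[i-1,i]$ for $i=1,\ldots,k$, and let $I_j=[a_j,b_j]$ ($a_j\leq b_j$ real) be such that $a_j\in\mathbb{N}_0$ and $I_j\subseteq[0,k]\setminus\{k\}$ for all $j=1,\ldots,r$. The interval graph on the vertex set $\{J_i\}_{i=0}^{k}\cup\{I_j\}_{j=1}^{r}$ is called a connected strongly interval graph. A graph is called a strongly interval graph if every connected component of it is isomorphic to a connected strongly interval graph (for some $k$, $r$ and intervals depending on the component). *)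

(* Defs.v *)
From mathcomp Require Import all_boot all_order all_algebra.
From mathcomp Require Import boolp classical_sets set_interval reals.

Set Implicit Arguments.
Unset Strict Implicit.
Unset Printing Implicit Defensive.

Import Order.TTheory GRing.Theory Num.Theory.

(* A finite simple graph is a symmetric irreflexive [e : rel T] on a finType. *)

Definition induced_embedding (S T : finType) (d : rel S) (e : rel T)
    (f : S -> T) : bool :=
  injectiveb f && [forall x, forall y, e (f x) (f y) == d x y].

Definition graph_iso (S T : finType) (d : rel S) (e : rel T) : Prop :=
  exists f : S -> T, bijective f /\ forall x y, e (f x) (f y) = d x y.

Definition induced_subgraph (T : finType) (e : rel T) (C : {set T}) :
    rel {x : T | x \in C} :=
  fun u v => e (val u) (val v).

Definition components (T : finType) (e : rel T) : {set {set T}} :=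
  equivalence_partition (connect e) [set: T].

(* [path_graph n] has n edges, hence n.+1 vertices. *)
Definition path_graph (n : nat) : rel 'I_n.+1 :=
  fun i j => (j == i.+1 :> nat) || (i == j.+1 :> nat).

(* [ordS] is the cyclic successor i |-> i + 1 mod n; the relation is the cycle
   with n edges only for n >= 3. *)
Definition cycle_graph (n : nat) : rel 'I_n :=
  fun i j => (j == ordS i) || (i == ordS j).

Definition chordal (T : finType) (e : rel T) : Prop :=
  forall (n : nat) (f : 'I_n -> T),
    3 < n -> ~~ induced_embedding (@cycle_graph n) e f.

(* The bound n < #|T| loses nothing: a path of length n has n.+1 vertices. *)
Definition longest_induced_path (T : finType) (e : rel T) : nat :=
  \max_(n < #|T| | [exists f : {ffun 'I_n.+1 -> T},
                      induced_embedding (@path_graph n) e f]) n.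

Definition Lsum (T : finType) (e : rel T) : nat :=
  \sum_(C in components e) longest_induced_path (induced_subgraph e (C := C)).

Definition clique (T : finType) (e : rel T) (K : {set T}) : bool :=
  [forall x in K, forall y in K, (x != y) ==> e x y].

(* Cliques are taken nonempty, so that the graph without vertices has no
   maximal clique; for all other graphs this makes no difference. *)
Definition max_clique (T : finType) (e : rel T) (K : {set T}) : bool :=
  maxset (fun A : {set T} => (0 < #|A|) && clique e A) K.

Definition num_max_cliques (T : finType) (e : rel T) : nat :=
  #|[set K : {set T} | max_clique e K]|.

Definition interval_graph (R : realType) (V : finType) (J : V -> set R) :
    rel V :=
  fun u v => (u != v) && `[< (J u `&` J v !=set0)%classic >].

Local Open Scope ring_scope.

Definition base_interval (R : realType) (i : nat) : set R :=
  if i is j.+1 then `[j%:R, j.+1%:R]%classic else `[0, 0]%classic.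

Definition csi_family (R : realType) (k r : nat) (a : 'I_r -> nat)
    (b : 'I_r -> R) (v : 'I_k.+1 + 'I_r) : set R :=
  match v with
  | inl i => base_interval i
  | inr j => `[(a j)%:R, b j]%classic
  end.

Definition connected_strongly_interval (R : realType) (T : finType)
    (e : rel T) : Prop :=
  exists (k r : nat) (a : 'I_r -> nat) (b : 'I_r -> R),
    [/\ (0 < k)%N,
        forall j, (a j)%:R <= b j,
        forall j, (`[(a j)%:R, b j] `<=` `[0, k%:R] `\ k%:R)%classic
      & graph_iso e (interval_graph (@csi_family R k r a b))].

Definition strongly_interval (R : realType) (T : finType) (e : rel T) : Prop :=
  forall C, C \in components e ->
    connected_strongly_interval R (induced_subgraph e (C := C)).

(* Main.v *)
Require Import Defs.
From mathcomp Require Import boolp classical_sets set_interval reals.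
From mathcomp Require Import all_boot all_order all_algebra zify.

Set Implicit Arguments.
Unset Strict Implicit.
Unset Printing Implicit Defensive.

Import Order.TTheory GRing.Theory Num.Theory.

(* A clique contains at most two consecutive vertices of an induced path, so the
   k edges of a longest induced path p_0, ..., p_k lie in distinct maximal
   cliques and L <= c componentwise. If c = k, these cliques K_1, ..., K_k are
   all the maximal cliques, and K_i consists of the vertices equal or adjacent
   to both p_(i-1) and p_i. By chordality the neighbours of a vertex on the path
   are consecutive, so {i | w \in K_i} is an interval of indices; these
   intervals, shifted by one, realise the graph as an interval graph. *)

(** * Cliques and induced paths *)

Section Graph.
Variables (T : finType) (e : rel T).
Hypotheses (e_sym : symmetric e) (e_irr : irreflexive e).

Lemma cliqueP (K : {set T}) :
  reflect {in K &, forall x y, x != y -> e x y} (clique e K).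
Proof.
apply: (iffP forall_inP) => [h x y xK yK xy|h x xK].
  by move/forall_inP: (h x xK) => /(_ y yK) /implyP; apply.
by apply/forall_inP => y yK; apply/implyP; apply: h.
Qed.

Lemma max_cliqueP (K : {set T}) :
  reflect [/\ K != set0, clique e K
            & forall B : {set T}, clique e B -> K \subset B -> B = K]
          (max_clique e K).
Proof.
apply: (iffP maxsetP) => [[/andP[K0 cK] mK]|[K0 cK mK]].
  split=> // [|B cB KB]; first by rewrite -card_gt0.
  by apply: mK => //; rewrite cB andbT (leq_trans K0) // subset_leq_card.
by split=> [|B /andP[_]]; [rewrite card_gt0 K0 | apply: mK].
Qed.

Lemma max_clique_extend (A : {set T}) :
  A != set0 -> clique e A -> exists2 K, max_clique e K & A \subset K.
Proof.
move=> A0 cA.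
have [|K mK AK] := @maxset_exists _
  (fun A : {set T} => (0 < #|A|) && clique e A) A; last by exists K.
by rewrite card_gt0 A0.
Qed.

Lemma clique1 x : clique e [set x].
Proof. by apply/cliqueP => y z /set1P-> /set1P->; rewrite eqxx. Qed.

Lemma cliqueU1 x (A : {set T}) :
  clique e A -> {in A, forall y, x != y -> e x y} -> clique e (x |: A).
Proof.
move=> /cliqueP cA xA; apply/cliqueP => y z /setU1P[->|yA] /setU1P[->|zA] yz.
- by rewrite eqxx in yz.
- exact: xA.
- by rewrite e_sym xA // eq_sym.
- exact: cA.
Qed.

(** A path is a function on [nat] constrained only at indices up to [n], so that successors and
    subpaths need no ordinal arithmetic. *)
Definition is_induced_path n (p : nat -> T) :=
  {in gtn n.+1 &, injective p} /\
  {in gtn n.+1 &, forall i j, e (p i) (p j) = (j == i.+1) || (i == j.+1)}.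

Lemma induced_pathP n :
  reflect (exists p, is_induced_path n p)
    [exists f : {ffun 'I_n.+1 -> T}, induced_embedding (@path_graph n) e f].
Proof.
apply: (iffP existsP) => [[f /andP[/injectiveP f_inj /forallP fe]]|[p [pI pE]]].
  have fE (i j : 'I_n.+1) : e (f i) (f j) = path_graph i j.
    by move/forallP: (fe i) => /(_ j) /eqP.
  exists (fun i => f (inord i)); split=> i j; rewrite !inE => ilt jlt.
    by move=> /f_inj /(congr1 val); rewrite /= !inordK.
  by rewrite fE /path_graph !inordK.
exists [ffun i : 'I_n.+1 => p i]; apply/andP; split.
  apply/injectiveP => i j; rewrite !ffunE => /pI h.
  by apply/val_inj/h; rewrite inE.
by apply/forallP => i; apply/forallP => j; rewrite !ffunE pE ?inE.
Qed.

Lemma longest_induced_path_max n p :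
  is_induced_path n p -> n <= longest_induced_path e.
Proof.
move=> pP; have [pI _] := pP.
have nT : n < #|T|.
  suff /leq_card : injective (fun i : 'I_n.+1 => p i) by rewrite card_ord.
  by move=> i j /pI h; apply/val_inj/h; rewrite inE.
rewrite /longest_induced_path.
rewrite (bigD1 (Ordinal nT)) /=; first exact: leq_maxl.
by apply/(induced_pathP n); exists p.
Qed.

(** A single vertex is an induced path of length 0, so the maximum is taken over a nonempty
    range. *)
Lemma longest_induced_path_attained :
  0 < #|T| -> exists p, is_induced_path (longest_induced_path e) p.
Proof.
move=> T0; have [x _] := card_gt0P T0.
have [|i pP iE] := @eq_bigmax_cond _ (fun n : 'I_#|T| =>
  [exists f : {ffun 'I_n.+1 -> T}, induced_embedding (@path_graph n) e f])
  (@nat_of_ord _); last first.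
  by rewrite (iE : longest_induced_path e = i); apply/induced_pathP.
apply/card_gt0P; exists (Ordinal T0); apply/induced_pathP.
exists (fun=> x); split=> -[|//] [|//] _ _ //=.
Qed.

(** * Maximal cliques along an induced path *)

Section Path.
Variables (n : nat) (p : nat -> T).
Hypothesis pP : is_induced_path n p.

Let p_inj i j : i <= n -> j <= n -> p i = p j -> i = j.
Proof. by move=> ? ?; apply: (proj1 pP); rewrite inE ltnS. Qed.

Let p_adj i j : i <= n -> j <= n -> e (p i) (p j) = (j == i.+1) || (i == j.+1).
Proof. by move=> ? ?; apply: (proj2 pP); rewrite inE ltnS. Qed.

Lemma path_edge_cliques : exists K : 'I_n -> {set T},
  forall i : 'I_n, [/\ max_clique e (K i), p i \in K i & p i.+1 \in K i].
Proof.
apply: (fin_all_exists (P := fun (i : 'I_n) (A : {set T}) =>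
  [/\ max_clique e A, p i \in A & p i.+1 \in A])) => i.
have ilt := ltn_ord i.
have [||K mK] := @max_clique_extend (p i |: [set p i.+1]).
- by apply/set0Pn; exists (p i); rewrite setU11.
- apply: cliqueU1; first exact: clique1.
  by move=> _ /set1P-> _; rewrite p_adj ?eqxx // ltnW.
rewrite subUset !sub1set => /andP[? ?].
by exists K.
Qed.

(** Distinct vertices of a clique are adjacent, and path vertices are adjacent only at consecutive
    indices. *)
Lemma path_in_clique (K : {set T}) i j : clique e K -> i <= n -> j <= n ->
  p i \in K -> p j \in K -> j <= i.+1.
Proof.
move=> /cliqueP cK ilt jlt iK jK; rewrite leqNgt; apply/negP => ij.
have /cK -/(_ iK jK) : p i != p j.
  by apply/eqP => /p_inj; lia.
rewrite p_adj //; lia.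
Qed.

Variable K : 'I_n -> {set T}.
Hypothesis KP :
  forall i : 'I_n, [/\ max_clique e (K i), p i \in K i & p i.+1 \in K i].

Let K_clique i : clique e (K i).
Proof. by have [/max_cliqueP[]] := KP i. Qed.

(** If [K i = K j], this clique holds both [p j] and [p i.+1], which forces [i <= j]; symmetry does
    the rest. *)
Lemma edge_clique_inj : injective K.
Proof.
suff h i j : K i = K j -> i <= j.
  by move=> i j Kij; apply/val_inj/anti_leq; rewrite !h.
move=> Kij; have [_ _ pi1K] := KP i; have [_ pjK _] := KP j.
rewrite Kij in pi1K.
exact: path_in_clique (K_clique j) (ltnW (ltn_ord j)) (ltn_ord i) pjK pi1K.
Qed.

Lemma path_length_le_cliques : n <= num_max_cliques e.
Proof.
rewrite -[n]card_ord -(card_imset _ edge_clique_inj) subset_leq_card //.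
by apply/subsetP => _ /imsetP[i _ ->]; rewrite inE; have [] := KP i.
Qed.

(** * Graphs with as many maximal cliques as path edges *)

Hypothesis nE : num_max_cliques e = n.

(** The [n] distinct cliques [K i] exhaust the [n] maximal cliques by counting. *)
Lemma max_clique_edge A : max_clique e A -> exists i, A = K i.
Proof.
move=> mA.
have sub : K @: setT \subset [set A | max_clique e A].
  by apply/subsetP => _ /imsetP[i _ ->]; rewrite inE; have [] := KP i.
have /eqP KE : K @: setT == [set A | max_clique e A].
  rewrite eqEcard sub (card_imset _ edge_clique_inj) cardsT card_ord.
  by move: nE; rewrite /num_max_cliques /= => ->.
have : A \in K @: setT by rewrite KE inE.
by case/imsetP => i _ ->; exists i.
Qed.

Lemma clique_sub_edge (A : {set T}) :
  A != set0 -> clique e A -> exists i, A \subset K i.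
Proof.
move=> A0 cA; have [B /max_clique_edge[i ->] AB] := max_clique_extend A0 cA.
by exists i.
Qed.

(** From right to left, [x], [p i] and [p i.+1] form a clique, contained in some [K j]; a clique
    with [p i], [p i.+1], [p j] and [p j.+1] forces [j = i]. *)
Lemma mem_edge_clique x (i : 'I_n) :
  (x \in K i) = ((x == p i) || e x (p i)) && ((x == p i.+1) || e x (p i.+1)).
Proof.
have [mK piK pi1K] := KP i; have ilt := ltn_ord i.
apply/idP/andP => [xK|[xi xi1]].
  by have /cliqueP cK := K_clique i; split; case: eqP => //= /eqP ?; apply: cK.
have [||j] := @clique_sub_edge (x |: (p i |: [set p i.+1])).
- by apply/set0Pn; exists x; rewrite setU11.
- apply: cliqueU1; first apply: cliqueU1; first exact: clique1.
    by move=> _ /set1P-> _; rewrite p_adj ?eqxx // ltnW.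
  by move=> _ /setU1P[->|/set1P->] /negPf xp; rewrite xp /= in xi xi1.
rewrite !subUset !sub1set => /and3P[xj pij pi1j].
have [_ pj pj1] := KP j; have jlt := ltn_ord j.
have h1 := path_in_clique (K_clique j) (ltnW jlt) ilt pj pi1j.
have h2 := path_in_clique (K_clique j) (ltnW ilt) jlt pij pj1.
by have -> : i = j by apply/val_inj/anti_leq/andP.
Qed.

Lemma path_mem_edge_clique t (i : 'I_n) : t <= n ->
  (p t \in K i) = (i <= t <= i.+1).
Proof.
move=> tn; have ilt := ltn_ord i; rewrite mem_edge_clique !p_adj //; last lia.
have pE j : j <= n -> (p t == p j) = (t == j).
  by move=> jn; apply/eqP/eqP => [/p_inj|->//]; apply.
by rewrite !pE //; lia.
Qed.

(** * Chordality and convexity *)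

Hypothesis e_chordal : chordal e.

(* Otherwise x and the path from p s to p t form an induced cycle. *)
Lemma induced_path_chord x s t : (forall i, i <= n -> x != p i) ->
    s.+1 < t -> t <= n -> e x (p s) -> e x (p t) ->
  exists2 m, s < m < t & e x (p m).
Proof.
move=> xp st tn xs xt.
have [/existsP[m /andP[m1 m2]]|/existsPn nm] := boolP
  [exists m : 'I_t, (s < m) && e x (p m)].
  by exists m => //; rewrite m1 /=.
exfalso.
(* With no neighbour strictly between, [x] sees only the two ends of the segment. *)
have xm m : s <= m <= t -> e x (p m) = (m == s) || (m == t).
  move=> /andP[sm mt]; have [->//|ms] /= := eqVneq m s.
  have [->//|mt'] /= := eqVneq m t.
  have mlt : m < t by lia.
  by have := nm (Ordinal mlt); rewrite negb_and /=; case: ltnP => [_ /negPf|]; lia.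
(* The cycle has t - s + 1 path vertices followed by [x] at the last index; its length is at least 4
   because s + 1 < t. *)
set N := (t - s).+2.
pose g (i : 'I_N) := if i == N.-1 :> nat then x else p (s + i).
have N3 : 3 < N by lia.
apply: (negP (e_chordal g N3)).
apply/andP; split.
  apply/injectiveP => i j; rewrite /g => gij; apply/val_inj => /=.
  have ilt := ltn_ord i; have jlt := ltn_ord j; move: gij.
  case: eqP => [iN|iN]; case: eqP => [jN|jN]; first by rewrite iN jN.
  - by move/eqP; rewrite (negPf (xp _ _)) //; lia.
  - by move/eqP; rewrite eq_sym (negPf (xp _ _)) //; lia.
  - by move/p_inj; lia.
(* The cyclic successor becomes a case split, so that [lia] can handle the wrap-around. *)
have ordSE (i j : 'I_N) :
    (j == ordS i) = (j == (if i == N.-1 :> nat then 0 else i.+1) :> nat).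
  rewrite -val_eqE /=; congr (_ == _).
  have ilt := ltn_ord i; case: eqP => [->|h].
    by rewrite modnn.
  by rewrite modn_small; lia.
apply/forallP => i; apply/forallP => j; apply/eqP.
have ilt := ltn_ord i; have jlt := ltn_ord j.
rewrite /cycle_graph !ordSE /g.
case: eqP => [iN|iN]; case: eqP => [jN|jN].
- by rewrite e_irr; lia.
- by rewrite xm; lia.
- by rewrite e_sym xm; lia.
- by rewrite p_adj; lia.
Qed.

(** Induction on [t - s]: a neighbour strictly between splits the range into two shorter ones, one
    of which contains [m]. *)
Lemma path_nbhd_convex x s t m : (forall i, i <= n -> x != p i) ->
  t <= n -> e x (p s) -> e x (p t) -> s <= m <= t -> e x (p m).
Proof.
move=> xp; have [d] := ubnP (t - s); elim: d s t => // d IH s t dst tn xs xt smt.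
have [ts|ts] := leqP t s.+1.
  by have [->|->] : m = s \/ m = t by lia.
have [m' m's xm'] := induced_path_chord xp ts tn xs xt.
have [mm'|mm'] := leqP m m'.
  by apply: (IH s m') => //; lia.
by apply: (IH m' t) => //; lia.
Qed.

(** A vertex off the path is adjacent to [p i] and [p j.+1], hence to everything between, including
    both ends of edge [m]. A path vertex lies only in the cliques of its own edges. *)
Lemma edge_clique_convex x (i j m : 'I_n) :
  i <= m <= j -> x \in K i -> x \in K j -> x \in K m.
Proof.
move=> imj xi xj; have jlt := ltn_ord j.
have [/existsP[t /eqP xt]|/existsPn nx] := boolP [exists t : 'I_n.+1, x == p t].
  have tlt := ltn_ord t; move: xi xj.
  by rewrite xt !path_mem_edge_clique //; lia.
have xp k : k <= n -> x != p k by rewrite -ltnS => kn; apply: (nx (Ordinal kn)).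
have eK k : x \in K k -> e x (p k) && e x (p k.+1).
  have klt := ltn_ord k.
  by rewrite mem_edge_clique (negPf (xp _ _)) // ?(negPf (xp _ _)) // ltnW.
have /andP[xi0 _] := eK _ xi; have /andP[_ xj1] := eK _ xj.
have xadj k : i <= k <= j.+1 -> e x (p k).
  exact: (path_nbhd_convex xp jlt xi0 xj1).
by rewrite mem_edge_clique !xadj ?orbT //; lia.
Qed.

(** The bounds are the least and greatest index of a clique containing [x], packed into one pair so
    that [choice] applies. *)
Lemma edge_clique_interval x : exists lohi : nat * nat,
  lohi.1 <= lohi.2 < n /\ forall i : 'I_n, (x \in K i) = (lohi.1 <= i <= lohi.2).
Proof.
have [||i0] := @clique_sub_edge [set x].
- by apply/set0Pn; exists x; rewrite set11.
- exact: clique1.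
rewrite sub1set => xi0.
case: (@arg_minnP _ i0 (fun i => x \in K i) (@nat_of_ord n) xi0) => lo xlo lomin.
case: (@arg_maxnP _ i0 (fun i => x \in K i) (@nat_of_ord n) xi0) => hi xhi himax.
exists (lo : nat, hi : nat); split=> /=.
  by rewrite ltn_ord andbT; apply: lomin.
move=> i; apply/idP/idP => [xi|loihi].
  by rewrite lomin //=; apply: himax.
exact: (edge_clique_convex loihi).
Qed.

Lemma adj_edge_clique x y :
  x != y -> e x y <-> exists i, (x \in K i) && (y \in K i).
Proof.
move=> xy; split=> [exy|[i /andP[xi yi]]]; last first.
  by have /cliqueP cK := K_clique i; apply: cK.
have [||i] := @clique_sub_edge (x |: [set y]).
- by apply/set0Pn; exists x; rewrite setU11.
- by apply: cliqueU1; [exact: clique1 | move=> _ /set1P->].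
by rewrite subUset !sub1set => h; exists i.
Qed.

End Path.
End Graph.

Lemma longest_induced_path_le_cliques (T : finType) (e : rel T) :
  symmetric e -> irreflexive e ->
  longest_induced_path e <= num_max_cliques e.
Proof.
move=> e_sym e_irr.
have [T0|/(longest_induced_path_attained e_irr) [p pP]] := posnP #|T|.
  (* Without vertices the maximum has an empty range and equals 0. *)
  by rewrite /longest_induced_path big1 // => i; have := ltn_ord i; rewrite {2}T0.
have [K KP] := path_edge_cliques e_sym pP.
exact: (path_length_le_cliques pP KP).
Qed.

(** * Decomposition into connected components *)

Section Components.
Variables (T : finType) (e : rel T).
Hypotheses (e_sym : symmetric e) (e_irr : irreflexive e).

Lemma componentE C x : C \in components e -> x \in C ->
  C = [set y | connect e x y].
Proof.
case/imsetP => y _ ->; rewrite !inE /= => yx; apply/setP => z; rewrite !inE /=.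
exact: (same_connect (sym_connect_sym e_sym) yx z).
Qed.

Lemma component_mem x : [set y | connect e x y] \in components e.
Proof. by apply/imsetP; exists x => //; apply/setP => y; rewrite !inE. Qed.

Lemma component_neq0 C : C \in components e -> C != set0.
Proof.
by case/imsetP => x _ ->; apply/set0Pn; exists x; rewrite !inE /= connect0.
Qed.

Lemma clique_sub_component C K x : C \in components e ->
  clique e K -> x \in K -> x \in C -> K \subset C.
Proof.
move=> Ccomp /cliqueP cK xK xC; apply/subsetP => y yK.
rewrite (componentE Ccomp xC) inE; have [->|xy] := eqVneq x y => //.
exact/connect1/cK.
Qed.

Section Component.
Variables (C : {set T}) (Ccomp : C \in components e).

Lemma imset_val_preim (K : {set T}) :
  K \subset C -> [set val x | x : {x | x \in C} in val @^-1: K] = K.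
Proof.
move=> /subsetP KC; apply/setP => x; apply/imsetP/idP => [[y]|xK].
  by rewrite inE => yK ->.
by exists (exist _ x (KC x xK)); rewrite ?inE.
Qed.

Lemma clique_imset_val (K : {set {x | x \in C}}) :
  clique e (val @: K) = clique (induced_subgraph e (C := C)) K.
Proof.
apply/cliqueP/cliqueP => cK x y.
  by move=> xK yK xy; apply: cK; rewrite ?imset_f // (inj_eq val_inj).
move=> /imsetP[u uK ->] /imsetP[v vK ->].
by rewrite (inj_eq val_inj); apply: cK.
Qed.

(** A clique of [e] containing the image of a nonempty [K] meets [C], so it lies in [C] and pulls
    back. *)
Lemma max_clique_imset_val (K : {set {x | x \in C}}) :
  max_clique e (val @: K) = max_clique (induced_subgraph e (C := C)) K.
Proof.
apply/max_cliqueP/max_cliqueP => -[K0 cK mK].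
  split=> [||B cB KB]; last 1 first.
  - by apply/(imset_inj val_inj)/mK; rewrite ?clique_imset_val ?imsetS.
  - by apply: contraNneq K0 => ->; rewrite imset0.
  - by rewrite -clique_imset_val.
have [x xK] := set0Pn _ K0.
split=> [||B cB KB].
- by apply/set0Pn; exists (val x); rewrite imset_f.
- by rewrite clique_imset_val.
have /imset_val_preim BE : B \subset C.
  apply: (clique_sub_component Ccomp cB) (valP x).
  by apply: (subsetP KB); rewrite imset_f.
suff <- : val @^-1: B = K by [].
apply: mK; first by rewrite -clique_imset_val BE.
by apply/subsetP => y yK; rewrite inE (subsetP KB) ?imset_f.
Qed.

Lemma card_max_cliques_component :
  #|[set K : {set T} | max_clique e K & K \subset C]| =
  num_max_cliques (induced_subgraph e (C := C)).
Proof.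
rewrite /num_max_cliques -[RHS](card_imset _ (imset_inj val_inj)).
apply: eq_card => K; rewrite inE.
apply/andP/imsetP => [[mK KC]|[K']].
  exists (val @^-1: K); last by rewrite imset_val_preim.
  by rewrite inE -max_clique_imset_val imset_val_preim.
rewrite inE -max_clique_imset_val => mK' ->; split=> //.
by apply/subsetP => _ /imsetP[x _ ->]; apply: valP.
Qed.

End Component.

(** A maximal clique is nonempty and connected, so it lies in exactly one component. *)
Lemma num_max_cliques_components :
  num_max_cliques e =
  \sum_(C in components e) num_max_cliques (induced_subgraph e (C := C)).
Proof.
(* The default [set0] never arises for a maximal clique. *)
pose comp_of (K : {set T}) : {set T} :=
  if [pick x in K] is Some x then [set y | connect e x y] else set0.
have comp_ofP K C : C \in components e -> max_clique e K ->
    (comp_of K == C) = (K \subset C).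
  move=> Ccomp /max_cliqueP[/set0Pn[x0 x0K] cK _]; rewrite /comp_of.
  case: pickP => [x xK|/(_ x0)]; last by rewrite x0K.
  apply/eqP/idP => [CE|/subsetP KC].
    by apply: (clique_sub_component Ccomp cK xK); rewrite -CE inE connect0.
  by rewrite -(componentE Ccomp (KC x xK)).
rewrite /num_max_cliques -sum1dep_card.
rewrite (partition_big comp_of (mem (components e))) /=; last first.
  move=> K /max_cliqueP[/set0Pn[x0 x0K] _ _]; rewrite /comp_of.
  by case: pickP => [x _|/(_ x0)]; [exact: component_mem | rewrite x0K].
apply: eq_bigr => C Ccomp.
rewrite -/(num_max_cliques _) -(card_max_cliques_component Ccomp) -sum1dep_card.
by apply: eq_bigl => K; apply: andb_id2l => /comp_ofP->.
Qed.

(** The inequality holds term by term, so equality of the sums forces equality of all terms. *)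
Lemma Lsum_eq_num_max_cliques :
  Lsum e = num_max_cliques e <->
  forall C, C \in components e ->
    longest_induced_path (induced_subgraph e (C := C)) =
    num_max_cliques (induced_subgraph e (C := C)).
Proof.
rewrite num_max_cliques_components; split=> [|LE]; last exact: eq_bigr.
have le (C : {set T}) : C \in components e ->
    longest_induced_path (induced_subgraph e (C := C)) <=
    num_max_cliques (induced_subgraph e (C := C)) ?= iff
    (longest_induced_path (induced_subgraph e (C := C)) ==
     num_max_cliques (induced_subgraph e (C := C))).
  move=> _; split=> //; apply: longest_induced_path_le_cliques => [x y|x].
    exact: e_sym.
  exact: e_irr.
move=> /eqP; rewrite (leqif_sum le) => /forall_inP LE C Ccomp.
exact/eqP/LE.
Qed.

Lemma chordal_induced_subgraph C :
  chordal e -> chordal (induced_subgraph e (C := C)).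
Proof.
move=> e_chordal n f n3; apply: contra (e_chordal n (val \o f) n3).
move=> /andP[/injectiveP f_inj fE]; apply/andP; split=> //.
exact/injectiveP/(inj_comp val_inj).
Qed.

End Components.

(** * Interval models *)

Section Interval.
Variable R : realType.
Local Open Scope ring_scope.

Lemma itvcc_meet (a b c d : R) : a <= b -> c <= d ->
  (`[a, b] `&` `[c, d] !=set0)%classic <-> (a <= d) && (c <= b).
Proof.
move=> ab cd; split=> [[x []]|/andP[ad cb]].
  rewrite /= !in_itv /= => /andP[ax xb] /andP[cx xd].
  by rewrite (le_trans ax xd) (le_trans cx xb).
(* Intervals that meet share their larger left endpoint. *)
exists (Num.max a c); split; rewrite /= in_itv /= ge_max le_max lexx ?orbT.
  by rewrite ab cb.
by rewrite ad cd.
Qed.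

(** The predecessor truncates at 0, so one formula covers the point [J_0] and the unit intervals. *)
Definition csi_left k r (a : 'I_r -> nat) (v : 'I_k.+1 + 'I_r) : nat :=
  match v with inl i => i.-1 | inr j => a j end.

Definition csi_right k r (b : 'I_r -> R) (v : 'I_k.+1 + 'I_r) : R :=
  match v with inl i => i%:R | inr j => b j end.

Lemma csi_familyE k r (a : 'I_r -> nat) (b : 'I_r -> R) (v : 'I_k.+1 + 'I_r) :
  csi_family a b v = `[(csi_left a v)%:R, csi_right b v]%classic.
Proof. by case: v => [[[|i] ilt]|j]. Qed.

Lemma csi_left_le_right k r (a : 'I_r -> nat) (b : 'I_r -> R)
    (v : 'I_k.+1 + 'I_r) :
  (forall j, (a j)%:R <= b j) -> (csi_left a v)%:R <= csi_right b v.
Proof. by move=> ab; case: v => [i|j] //=; rewrite ler_nat leq_pred. Qed.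

Lemma interval_graph_csi k r (a : 'I_r -> nat) (b : 'I_r -> R)
    (u v : 'I_k.+1 + 'I_r) : (forall j, (a j)%:R <= b j) ->
  interval_graph (csi_family a b) u v =
    [&& u != v, (csi_left a u)%:R <= csi_right b v
              & (csi_left a v)%:R <= csi_right b u].
Proof.
move=> ab; rewrite /interval_graph; congr (_ && _).
rewrite !csi_familyE; apply/asboolP/idP => [/itvcc_meet h|h].
  by apply: h; apply: csi_left_le_right.
by apply/itvcc_meet => //; apply: csi_left_le_right.
Qed.

Section Graph.
Variables (T : finType) (e : rel T).
Hypotheses (e_sym : symmetric e) (e_irr : irreflexive e).

(* By Helly's theorem on the line a clique has a common point, which can be
   taken to be its largest left endpoint, one of 0, ..., k - 1; so there are at
   most k maximal cliques, while J_0, ..., J_k is an induced path of length k. *)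
Lemma csi_longest_induced_path :
  connected_strongly_interval R e -> longest_induced_path e = num_max_cliques e.
Proof.
case=> k [r [a [b [k0 ab abk [g [[h gK hK] gE]]]]]].
pose lo x := csi_left a (g x); pose hi x := csi_right b (g x).
have eE x y : e x y = [&& x != y, (lo x)%:R <= hi y & (lo y)%:R <= hi x].
  by rewrite -gE interval_graph_csi // (can_eq gK).
have lohi x : (lo x)%:R <= hi x by apply: csi_left_le_right.
(* [I_j] contains its left endpoint and misses k; [J_i] starts at i - 1, or at 0 when i = 0. *)
have lok x : (lo x < k)%N.
  rewrite /lo; case: (g x) => [i|j] /=; first by have := ltn_ord i; lia.
  have [] := abk j (a j)%:R; first by rewrite /= in_itv /= lexx ab.
  rewrite /= in_itv /= ler_nat => /andP[_ ajk] /eqP; rewrite eqr_nat => ajk'.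
  by rewrite ltn_neqAle ajk'.
apply/anti_leq; rewrite longest_induced_path_le_cliques //=.
apply: (@leq_trans k); last first.
  apply: (@longest_induced_path_max _ _ _ (fun i => h (inl (inord i)))).
  split=> i j; rewrite !inE => ilt jlt.
    by move=> /(can_inj hK) [] /(congr1 val); rewrite /= !inordK.
  rewrite eE /lo /hi !hK (can_eq hK) /= !inordK // !ler_nat.
  have -> : (inl (inord i) == inl (inord j) :> 'I_k.+1 + 'I_r) = (i == j).
    apply/eqP/eqP => [[] /(congr1 val)|->//]; by rewrite /= !inordK.
  lia.
pose C (p : 'I_k) := [set x | (lo x <= p)%N && (p%:R <= hi x)].
have cC p : clique e (C p).
  apply/cliqueP => x y; rewrite !inE => /andP[xp px] /andP[yp py] xy.
  by rewrite eE xy (le_trans _ py) ?(le_trans _ px) // ler_nat.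
rewrite -[X in (_ <= X)%N]card_ord -cardsT.
(* There are at most k sets [C p], so it suffices that every maximal clique is one of them. *)
apply: leq_trans (leq_imset_card C _).
apply: subset_leq_card; apply/subsetP => K; rewrite inE.
case/max_cliqueP => /set0Pn[x0 x0K] /cliqueP cK mK.
have [x xK xmax] := arg_maxnP lo x0K.
apply/imsetP; exists (Ordinal (lok x)) => //.
(* Each interval of [K] starts no later than that of [x] and meets it, so it contains the left
   endpoint of [x]; maximality then gives equality. *)
apply/esym/mK => //; apply/subsetP => y yK.
rewrite inE (xmax y yK : lo y <= lo x)%N /=.
have [<-|xy] := eqVneq x y; first exact: lohi.
by have := cK x y xK yK xy; rewrite eE => /and3P[].
Qed.

Hypothesis e_chordal : chordal e.

Lemma longest_induced_path_csi : (0 < #|T|)%N ->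
  longest_induced_path e = num_max_cliques e -> connected_strongly_interval R e.
Proof.
move=> T0 LE; have [p pP] := longest_induced_path_attained e_irr T0.
move: (longest_induced_path e) LE pP => k LE pP; have nE := esym LE.
have [K KP] := path_edge_cliques e_sym pP.
(* A nonempty graph has a maximal clique, and k is their number. *)
have k0 : (0 < k)%N.
  have [x _] := card_gt0P T0.
  have [||A mA _] := @max_clique_extend _ e [set x].
  - by apply/set0Pn; exists x; rewrite set11.
  - exact: clique1.
  by rewrite LE; apply/card_gt0P; exists A; rewrite inE.
have [itv itvP] := choice
  (edge_clique_interval e_sym e_irr pP KP nE e_chordal).
pose P := [set p i | i : 'I_k.+1].
have p_inj : injective (fun i : 'I_k.+1 => p i).
  by move=> i j /(proj1 pP) ij; apply/val_inj/ij; rewrite inE.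
(* Path vertices play the [J_i]; every other vertex receives the range of indices of its cliques. *)
pose a (j : 'I_#|~: P|) := (itv (enum_val j)).1.
pose b (j : 'I_#|~: P|) : R := (itv (enum_val j)).2%:R.
have ab j : (a j)%:R <= b j.
  by rewrite ler_nat; have [/andP[]] := itvP (enum_val j).
pose h (v : 'I_k.+1 + 'I_#|~: P|) :=
  match v with inl i => p i | inr j => enum_val j end.
have h_inj : injective h.
  have pP' (i : 'I_k.+1) : p i \in P by apply: imset_f.
  move=> [i|i] [j|j] /= => [/p_inj->||| /enum_val_inj->] // pE.
    by have := enum_valP j; rewrite -pE inE pP'.
  by have := enum_valP i; rewrite pE inE pP'.
have [g hK gK] : bijective h.
  apply: inj_card_bij => //.
  by rewrite card_sum !card_ord -[X in (_ <= X + _)%N](card_ord k.+1)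
    -(card_imset _ p_inj) cardsC.
exists k, _, a, b; split=> //.
  move=> j x; rewrite /= !in_itv /= => /andP[ax xb].
  have [/andP[_ ltk] _] := itvP (enum_val j).
  have xk : x < k%:R by apply: (le_lt_trans xb); rewrite ltr_nat.
  split; last by apply/eqP; rewrite lt_eqF.
  by rewrite (ltW xk) (le_trans _ ax) ?ler0n.
exists g; split=> [|x y]; first by exists h.
rewrite interval_graph_csi // (can_eq gK).
have [->|xy] := eqVneq x y; first by rewrite e_irr.
(* All right endpoints are integers here, so comparisons in [R] reduce to [nat]. *)
pose hi (v : 'I_k.+1 + 'I_#|~: P|) : nat :=
  match v with inl i => i : nat | inr j => (itv (enum_val j)).2 end.
have hiE v : csi_right b v = (hi v)%:R by case: v.
pose lo (v : 'I_k.+1 + 'I_#|~: P|) := csi_left a v.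
(* [p t] lies in the cliques of index t - 1 and t, as far as these exist, which matches [J_t]. *)
have memK z (i : 'I_k) : (z \in K i) = (lo (g z) <= i <= hi (g z))%N.
  rewrite -{1}(gK z); case: (g z) => [t|j] /=; last first.
    by have [_ ->] := itvP (enum_val j).
  have tk : (t <= k)%N by rewrite -ltnS.
  rewrite (path_mem_edge_clique e_sym pP KP nE _ tk) /lo /=; lia.
rewrite !hiE !ler_nat -/(lo (g x)) -/(lo (g y)) /=.
have lolt z : (lo (g z) < k)%N.
  case: (g z) => [t|j] /=; first by have := ltn_ord t; lia.
  have [/andP[]] := itvP (enum_val j); rewrite /a; lia.
have lohi z : (lo (g z) <= hi (g z))%N.
  case: (g z) => [t|j] /=; first exact: leq_pred.
  by have [/andP[]] := itvP (enum_val j).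
apply/andP/idP => [[xy1 yx1]|]; last first.
  by move/(adj_edge_clique e_sym pP KP nE xy) => [i]; rewrite !memK; lia.
apply/(adj_edge_clique e_sym pP KP nE xy).
(* [J_k] reaches k, which indexes no clique; the larger left endpoint is a common point below k. *)
have mlt : (maxn (lo (g x)) (lo (g y)) < k)%N by rewrite gtn_max !lolt.
exists (Ordinal mlt); rewrite !memK /=.
have := lohi x; have := lohi y; lia.
Qed.

End Graph.
End Interval.

(** * The equivalence, component by component *)

Theorem theorem4p2 (R : realType) (T : finType) (e : rel T)
    (e_sym : symmetric e) (e_irr : irreflexive e) (e_chordal : chordal e) :
  Lsum e = num_max_cliques e <-> strongly_interval R e.
Proof.
have sym C : symmetric (induced_subgraph e (C := C)) by move=> x y; apply: e_sym.
have irr C : irreflexive (induced_subgraph e (C := C)) by move=> x; apply: e_irr.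
rewrite Lsum_eq_num_max_cliques //; split=> h C Ccomp; last first.
  exact: csi_longest_induced_path (sym C) (irr C) (h C Ccomp).
apply: (longest_induced_path_csi R (sym C) (irr C)) (h C Ccomp).
  exact: chordal_induced_subgraph.
have /set0Pn[x xC] := component_neq0 Ccomp.
by apply/card_gt0P; exists (exist _ x xC).
Qed.
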